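(* Let $x^\star\in\mathbb{R}^n$ be a local minimum of (MPBVC) at which GCQ holds. Then there exist multipliers $\mu^g\in\mathbb{R}^{n_g}$, $\mu^h\in\mathbb{R}^{n_h}$, $\mu^G\in\mathbb{R}^{n_G\cdot n_H}$ and $\mu^H\in\mathbb{R}^{n_H}$ such that $$\nabla f(x^\star)-\sum_{k}\mu^g_k\nabla g_k(x^\star)-\sum_{l}\mu^h_l\nabla h_l(x^\star)-\sum_{(i,j)}\mu^G_{ij}\nabla G_{i,j}(x^\star)-\sum_i\mu^H_i\nabla H_i(x^\star)=0$$ (sums over all indices), and - $g_k(x^\star)=0$ for all $k$; - $\mu^h_l\ge0$, $h_l(x^\star)\ge0$, $\mu^h_lh_l(x^\star)=0$ for all $l$; - $\mu^H_i=0$ for all $i\in\mathcal{I}^H_{(+,+)}\cup\mathcal{I}^H_{(+,0)}$; - $\mu^H_i\ge0$ for all $i\in\mathcal{I}_0^H$ for which there is no $j$ with $(i,j)\in\mathcal{I}_{(0,-)}$; - $\mu^H_i$ is free (no sign restriction) for all $i\in\mathcal{I}_0^H$ for which there is some $j$ with $(i,j)\in\mathcal{I}_{(0,-)}$; - $\mu^G_{ij}\ge0$ for all $(i,j)\in\mathcal{I}_{(+,0)}$, and $\mu^G_{ij}=0$ for all other $(i,j)$.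
   Context: Setting. Let $f,H_i,G_{i,j}:\mathbb{R}^n\to\mathbb{R}$ ($1\le i\le n_H$, $1\le j\le n_G$, with $n_H,n_G\ge1$), $g:\mathbb{R}^n\to\mathbb{R}^{n_g}$, $h:\mathbb{R}^n\to\mathbb{R}^{n_h}$ be twice continuously differentiable. (MPBVC) is the problem: minimize $f(x)$ subject to $g(x)=0$, $h(x)\ge0$, $H_i(x)\ge0$ for all $i$, and $G_{i,j}(x)H_i(x)\ge0$ for all $(i,j)$. Its feasible set is $X$. Index sets at a feasible point $x^\star$: let $\mathcal{I}_{(+,+)},\mathcal{I}_{(+,0)}$ be the sets of $(i,j)$ with $H_i(x^\star)>0$ and $G_{i,j}(x^\star)>0$, $=0$ respectively; let $\mathcal{I}_{(0,+)},\mathcal{I}_{(0,0)},\mathcal{I}_{(0,-)}$ be the sets of $(i,j)$ with $H_i(x^\star)=0$ and $G_{i,j}(x^\star)>0$, $=0$, $<0$ respectively. For each of these, $\mathcal{I}^H_{(\cdot,\cdot)}=\{i\mid \exists j:(i,j)\in\mathcal{I}_{(\cdot,\cdot)}\}$. Let $\mathcal{I}_0^H=\{i\mid H_i(x^\star)=0\}$ and $\mathcal{I}_h=\{l\mid h_l(x^\star)=0\}$. Cones. The tangent cone is $\mathcal{T}(X,x^\star)=\{d\in\mathbb{R}^n\mid \exists\, x^{(k)}\in X,\ t^{(k)}>0,\ t^{(k)}\to0,\ x^{(k)}\to x^\star,\ (x^{(k)}-x^\star)/t^{(k)}\to d\}$. The linearized cone $\mathcal{L}(x^\star)$ of (MPBVC)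 is, explicitly, the set of $d\in\mathbb{R}^n$ with $\nabla g_k(x^\star)^Td=0$ for all $k$; $\nabla h_l(x^\star)^Td\ge0$ for $l\in\mathcal{I}_h$; $\nabla H_i(x^\star)^Td=0$ for $i\in\mathcal{I}^H_{(0,-)}$; $\nabla H_i(x^\star)^Td\ge0$ for $i\in\mathcal{I}^H_{(0,0)}\cup\mathcal{I}^H_{(0,+)}$; $\nabla G_{i,j}(x^\star)^Td\ge0$ for $(i,j)\in\mathcal{I}_{(+,0)}$. The polar cone of $M\subseteq\mathbb{R}^n$ is $M^-=\{d\mid\langle d,x\rangle\le0\ \forall x\in M\}$. The Guignard constraint qualification (GCQ) holds at $x^\star$ if $\mathcal{L}(x^\star)^-=\mathcal{T}(X,x^\star)^-$. *)

(* Defs.v *)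
From mathcomp Require Import all_boot all_order all_algebra.
From mathcomp Require Import all_classical all_reals all_analysis.

Set Implicit Arguments.
Unset Strict Implicit.
Unset Printing Implicit Defensive.

Import Order.TTheory GRing.Theory Num.Theory.
Import numFieldNormedType.Exports.

Local Open Scope classical_set_scope.
Local Open Scope ring_scope.

Definition dotv (R : realType) (n : nat) (u v : 'rV[R]_n) : R :=
  \sum_(i < n) u ord0 i * v ord0 i.

Definition grad (R : realType) (n : nat) (f : 'rV[R]_n -> R) (x : 'rV[R]_n) :
    'rV[R]_n :=
  \row_(j < n) 'D_(delta_mx ord0 j) f x.

Definition coordf (R : realType) (n m : nat) (F : 'rV[R]_n -> 'rV[R]_m)
    (k : 'I_m) : 'rV[R]_n -> R :=
  fun x => F x ord0 k.

(* The Jacobian of the gradient is the Hessian matrix. *)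
Definition C2 (R : realType) (n : nat) (f : 'rV[R]_n -> R) : Prop :=
  [/\ forall x, differentiable f x,
      forall x, differentiable (grad f) x
    & continuous (fun x => 'J (grad f) x : 'M[R]_n)].

(* Minimize f x subject to g x = 0, h x >= 0, H_i x >= 0 and
   G_{i,j} x * H_i x >= 0. *)
Record mpbvc (R : realType) (n ng nh nH nG : nat) := Mpbvc {
  mp_f : 'rV[R]_n -> R ;
  mp_g : 'rV[R]_n -> 'rV[R]_ng ;
  mp_h : 'rV[R]_n -> 'rV[R]_nh ;
  mp_H : 'I_nH -> 'rV[R]_n -> R ;
  mp_G : 'I_nH -> 'I_nG -> 'rV[R]_n -> R
}.

Definition C2_data (R : realType) (n ng nh nH nG : nat)
    (P : mpbvc R n ng nh nH nG) : Prop :=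
  [/\ C2 (mp_f P),
      forall k, C2 (coordf (mp_g P) k),
      forall l, C2 (coordf (mp_h P) l),
      forall i, C2 (mp_H P i)
    & forall i j, C2 (mp_G P i j)].

Definition feasible (R : realType) (n ng nh nH nG : nat)
    (P : mpbvc R n ng nh nH nG) : set 'rV[R]_n :=
  [set x | [/\ forall k, mp_g P x ord0 k = 0,
               forall l, 0 <= mp_h P x ord0 l,
               forall i, 0 <= mp_H P i x
             & forall i j, 0 <= mp_G P i j x * mp_H P i x]].

Definition local_minimum (R : realType) (n ng nh nH nG : nat)
    (P : mpbvc R n ng nh nH nG) (xs : 'rV[R]_n) : Prop :=
  feasible P xs /\
  \forall x \near xs, feasible P x -> mp_f P xs <= mp_f P x.

(* In the names I_ab, a is the sign of H_i and b that of G_{i,j} at xs: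
   p (positive), 0, or m (negative). *)
Definition I_pp (R : realType) (n ng nh nH nG : nat)
    (P : mpbvc R n ng nh nH nG) (xs : 'rV[R]_n) : set ('I_nH * 'I_nG) :=
  [set ij | 0 < mp_H P ij.1 xs /\ 0 < mp_G P ij.1 ij.2 xs].

Definition I_p0 (R : realType) (n ng nh nH nG : nat)
    (P : mpbvc R n ng nh nH nG) (xs : 'rV[R]_n) : set ('I_nH * 'I_nG) :=
  [set ij | 0 < mp_H P ij.1 xs /\ mp_G P ij.1 ij.2 xs = 0].

Definition I_0p (R : realType) (n ng nh nH nG : nat)
    (P : mpbvc R n ng nh nH nG) (xs : 'rV[R]_n) : set ('I_nH * 'I_nG) :=
  [set ij | mp_H P ij.1 xs = 0 /\ 0 < mp_G P ij.1 ij.2 xs].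

Definition I_00 (R : realType) (n ng nh nH nG : nat)
    (P : mpbvc R n ng nh nH nG) (xs : 'rV[R]_n) : set ('I_nH * 'I_nG) :=
  [set ij | mp_H P ij.1 xs = 0 /\ mp_G P ij.1 ij.2 xs = 0].

Definition I_0m (R : realType) (n ng nh nH nG : nat)
    (P : mpbvc R n ng nh nH nG) (xs : 'rV[R]_n) : set ('I_nH * 'I_nG) :=
  [set ij | mp_H P ij.1 xs = 0 /\ mp_G P ij.1 ij.2 xs < 0].

Definition projH (nH nG : nat) (I : set ('I_nH * 'I_nG)) : set 'I_nH :=
  [set i | exists j, I (i, j)].

Definition I0H (R : realType) (n ng nh nH nG : nat)
    (P : mpbvc R n ng nh nH nG) (xs : 'rV[R]_n) : set 'I_nH :=
  [set i | mp_H P i xs = 0].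

Definition Ih (R : realType) (n ng nh nH nG : nat)
    (P : mpbvc R n ng nh nH nG) (xs : 'rV[R]_n) : set 'I_nh :=
  [set l | mp_h P xs ord0 l = 0].

Definition tangent_cone (R : realType) (n : nat) (X : set 'rV[R]_n)
    (xs : 'rV[R]_n) : set 'rV[R]_n :=
  [set d | exists (x : nat -> 'rV[R]_n) (t : nat -> R),
     [/\ forall k, X (x k),
         forall k, 0 < t k,
         t @ \oo --> (0 : R),
         x @ \oo --> xs
       & (fun k => (t k)^-1 *: (x k - xs)) @ \oo --> d]].

Definition linearized_cone (R : realType) (n ng nh nH nG : nat)
    (P : mpbvc R n ng nh nH nG) (xs : 'rV[R]_n) : set 'rV[R]_n :=
  [set d |
    [/\ forall k, dotv (grad (coordf (mp_g P) k) xs) d = 0,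
        forall l, Ih P xs l -> 0 <= dotv (grad (coordf (mp_h P) l) xs) d,
        forall i, projH (I_0m P xs) i -> dotv (grad (mp_H P i) xs) d = 0,
        forall i, (projH (I_00 P xs) `|` projH (I_0p P xs)) i ->
          0 <= dotv (grad (mp_H P i) xs) d
      & forall i j, I_p0 P xs (i, j) ->
          0 <= dotv (grad (mp_G P i j) xs) d]].

Definition polar (R : realType) (n : nat) (M : set 'rV[R]_n) : set 'rV[R]_n :=
  [set d | forall x, M x -> dotv d x <= 0].

Definition GCQ (R : realType) (n ng nh nH nG : nat)
    (P : mpbvc R n ng nh nH nG) (xs : 'rV[R]_n) : Prop :=
  polar (linearized_cone P xs) = polar (tangent_cone (feasible P) xs).

(* Main.v *)
(** At a local minimum [- grad f] lies in the polar of the tangent cone, hence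
    by GCQ in the polar of the linearized cone. The latter is polyhedral, so
    Farkas' lemma yields the multipliers. Farkas' lemma itself is proved by
    induction on the number of inequalities: this is purely algebraic and needs
    neither separation nor the closedness of finitely generated cones. *)

Require Import Defs.
From mathcomp Require Import all_boot all_order all_algebra.
From mathcomp Require Import all_classical all_reals all_analysis.
From mathcomp Require Import lra.
Import Order.TTheory GRing.Theory Num.Theory.
Import numFieldNormedType.Exports.
Local Open Scope classical_set_scope.
Local Open Scope ring_scope.

Section InnerProduct.
Context {R : realType} {n : nat}.
Implicit Types u v w : 'rV[R]_n.

Lemma dotvDl u v w : dotv (u + v) w = dotv u w + dotv v w.
Proof. by rewrite -big_split; apply: eq_bigr => i _; rewrite mxE mulrDl. Qed.

Lemma dotvDr u v w : dotv u (v + w) = dotv u v + dotv u w.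
Proof. by rewrite -big_split; apply: eq_bigr => i _; rewrite mxE mulrDr. Qed.

Lemma dotvZl a u v : dotv (a *: u) v = a * dotv u v.
Proof. by rewrite mulr_sumr; apply: eq_bigr => i _; rewrite mxE mulrA. Qed.

Lemma dotvZr a u v : dotv u (a *: v) = a * dotv u v.
Proof. by rewrite mulr_sumr; apply: eq_bigr => i _; rewrite mxE mulrCA. Qed.

Lemma dotvNl u v : dotv (- u) v = - dotv u v.
Proof. by rewrite -scaleN1r dotvZl mulN1r. Qed.

Lemma dotvv_ge0 u : 0 <= dotv u u.
Proof. by apply: sumr_ge0 => i _; rewrite -expr2 sqr_ge0. Qed.

Lemma dotvv_eq0 u : dotv u u = 0 -> u = 0.
Proof.
move=> /psumr_eq0P uu0; apply/rowP => i; rewrite mxE; apply/eqP.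
by rewrite -sqrf_eq0 expr2 uu0// => j _; rewrite -expr2 sqr_ge0.
Qed.

End InnerProduct.

(** If the constraints of [s] alone already force [0 <= dotv c d], then [i0] is redundant and gets
    multiplier 0; otherwise a violating [z] allows [a i0] to be eliminated by projection. As
    multipliers are functions on [I], [uniq s] lets the value at [i0] be set without disturbing the
    terms of [s]. *)
Lemma farkas_seq (R : realType) (n : nat) (I : eqType) (s : seq I)
    (a : I -> 'rV[R]_n) (c : 'rV[R]_n) : uniq s ->
  (forall d, (forall i, i \in s -> 0 <= dotv (a i) d) -> 0 <= dotv c d) ->
  exists lam : I -> R,
    (forall i, 0 <= lam i) /\ c = \sum_(i <- s) lam i *: a i.
Proof.
elim: s a c => [|i0 s IHs] a c /=.
  (* With no constraints, testing at [- c] gives [dotv c c <= 0], so [c = 0]. *)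
  move=> _ c_ge0; exists (fun=> 0); split=> //; rewrite big_nil.
  apply: dotvv_eq0; apply/eqP; rewrite eq_le dotvv_ge0 andbT.
  by have := c_ge0 (- 1 *: c); rewrite dotvZr mulN1r oppr_ge0; apply.
move=> /andP[i0s us] c_ge0.
have [|/existsNP[z /not_implyP[az_ge0 /negP]]] :=
    pselect (forall d, (forall i, i \in s -> 0 <= dotv (a i) d) ->
                       0 <= dotv c d).
  move=> /(IHs _ _ us)[lam [lam_ge0 ->]].
  exists (fun i => if i == i0 then 0 else lam i); split=> [i|].
    by case: eqP.
  rewrite big_cons eqxx scale0r add0r; apply: eq_big_seq => i si.
  by case: eqP si => // ->; rewrite (negPf i0s).
rewrite -ltNge => cz_lt0.
(* [z] violates the constraint [i0]; after scaling, [d + dotv (a i0) d *: y]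
   is the projection of [d] along [z] onto the hyperplane of [i0], and the
   induction hypothesis applies to the forms composed with it. *)
have a0z_lt0 : dotv (a i0) z < 0.
  rewrite ltNge; apply/negP => a0z_ge0; move: cz_lt0.
  rewrite ltNge c_ge0// => i.
  by rewrite inE => /predU1P[->//|/az_ge0].
have N_gt0 : 0 < - dotv (a i0) z by rewrite oppr_gt0.
pose y := (- dotv (a i0) z)^-1 *: z.
have a0y : dotv (a i0) y = -1.
  by rewrite dotvZr invrN mulNr mulVf ?lt_eqF.
have cy_le0 : dotv c y <= 0 by rewrite dotvZr pmulr_rle0 ?invr_gt0// ltW.
have ay_ge0 i : i \in s -> 0 <= dotv (a i) y.
  by move=> /az_ge0 azi; rewrite dotvZr mulr_ge0 ?invr_ge0// ltW.
have projE (b d : 'rV[R]_n) :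
    dotv (b + dotv b y *: a i0) d = dotv b (d + dotv (a i0) d *: y).
  by rewrite dotvDl dotvDr dotvZl (dotvZr _ b y) mulrC.
have [d ad_ge0|lam [lam_ge0 cE]] :=
    IHs (fun i => a i + dotv (a i) y *: a i0) (c + dotv c y *: a i0) us.
  rewrite projE; apply: c_ge0 => i; rewrite inE => /predU1P[->|si].
    by rewrite dotvDr (dotvZr _ _ y) a0y mulrN1 subrr.
  by rewrite -projE ad_ge0.
(* Solving [cE] for [c] leaves this coefficient on [a i0]. It is nonnegative since [dotv c y <= 0]
   and [0 <= dotv (a i) y] for [i] in [s]. *)
pose k := \sum_(i <- s) lam i * dotv (a i) y - dotv c y.
have k_ge0 : 0 <= k.
  rewrite subr_ge0 (le_trans cy_le0)// big_seq sumr_ge0// => i si.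
  by rewrite mulr_ge0// ay_ge0.
exists (fun i => if i == i0 then k else lam i); split=> [i|].
  by case: eqP.
rewrite big_cons eqxx (eq_big_seq (fun i => lam i *: a i)) /=; last first.
  by move=> i si; case: eqP si => // ->; rewrite (negPf i0s).
rewrite scalerBl addrAC scaler_suml -big_split /=; apply/eqP.
rewrite -subr_eq opprK; apply/eqP; rewrite cE; apply: eq_bigr => i _.
by rewrite scalerDr scalerA addrC.
Qed.

(** One finite type indexes all constraints, so that families of different kinds can be treated at
    once. [E] takes precedence over [A]: an index in both gets a multiplier of free sign. *)
Lemma farkas (R : realType) (n : nat) (I : finType) (E A : pred I)
    (a : I -> 'rV[R]_n) (c : 'rV[R]_n) :
  (forall d, (forall i, E i -> dotv (a i) d = 0) ->
             (forall i, A i -> 0 <= dotv (a i) d) -> 0 <= dotv c d) ->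
  exists lam : I -> R,
    [/\ c = \sum_i lam i *: a i,
        forall i, ~~ E i -> 0 <= lam i
      & forall i, ~~ E i -> ~~ A i -> lam i = 0].
Proof.
move=> c_ge0.
(* An equality is a pair of opposite inequalities; the second component says
   which, and inactive constraints are replaced by the zero vector. *)
pose b (p : I * bool) : 'rV[R]_n :=
  if p.2 then ((E p.1 || A p.1)%:R : R) *: a p.1
  else (- (E p.1)%:R : R) *: a p.1.
have [d bd_ge0|lam [lam_ge0 cE]] := @farkas_seq R n _ (index_enum _) b c
    (index_enum_uniq _).
  have pos i : E i || A i -> 0 <= dotv (a i) d.
    move=> EAi; have := bd_ge0 (i, true) (mem_index_enum _).
    by rewrite /b /= EAi scale1r.
  apply: c_ge0 => i Xi; last by rewrite pos// Xi orbT.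
  apply/eqP; rewrite eq_le pos ?Xi// andbT.
  have := bd_ge0 (i, false) (mem_index_enum _).
  by rewrite /b /= Xi scaleN1r dotvNl oppr_ge0.
(* The multiplier of an equality is the difference of those of its two opposite inequalities; the
   boolean factors discard the coefficients of zero vectors. *)
exists (fun i => (E i || A i)%:R * lam (i, true) - (E i)%:R * lam (i, false)).
split=> [|i /negPf ->|i /negPf -> /negPf ->]; last 2 first.
- by rewrite mul0r subr0 mulr_ge0.
- by rewrite !mul0r subrr.
rewrite cE (eq_bigr (fun p => lam (p.1, p.2) *: b (p.1, p.2))); last by case.
rewrite -(pair_bigA _ (fun i j => lam (i, j) *: b (i, j))) /=.
apply: eq_bigr => i _; rewrite big_bool /b /= !scalerA -scalerDl.
by rewrite mulrN (mulrC (lam (i, true))) (mulrC (lam (i, false))).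
Qed.

Lemma dotv_grad (R : realType) (n : nat) (f : 'rV[R]_n -> R) (x d : 'rV[R]_n) :
  differentiable f x -> dotv (grad f x) d = 'd f x d.
Proof.
move=> df; rewrite {2}(row_sum_delta d) linear_sum; apply: eq_bigr => i _.
by rewrite linearZ mxE deriveE// mulrC.
Qed.

(** Along a sequence defining [d], [f (x k) - f xs] equals [t k] times a quantity tending to
    ['d f xs d]. Were this limit negative, [f (x k)] would eventually drop below [f xs]. *)
Lemma tangent_cone_grad_ge0 (R : realType) (n : nat) (f : 'rV[R]_n -> R)
    (X : set 'rV[R]_n) (xs d : 'rV[R]_n) :
  differentiable f xs -> (\forall x \near xs, X x -> f xs <= f x) ->
  tangent_cone X xs d -> 0 <= dotv (grad f xs) d.
Proof.
move=> df fmin [x [t [Xx t_gt0 _ x_xs q_d]]].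
rewrite dotv_grad// leNgt; apply/negP => dfd_lt0.
have [L LE] : exists L : R, L = 'd f xs d by exists ('d f xs d).
rewrite -LE in dfd_lt0.
have N_gt0 : 0 < `|d| + 1 by rewrite ltr_wpDl.
(* This [e] keeps the remainder below [t k * (- L / 4)], while the linear term is below
   [t k * (L / 2)]; together they give [f (x k) - f xs < t k * L / 4 < 0]. *)
have [e e_gt0 eE] : exists2 e, 0 < e & e * (`|d| + 1) = - L / 4.
  exists (- L / 4 / (`|d| + 1)); last by rewrite divfK// gt_eqF.
  by rewrite !divr_gt0// oppr_gt0.
have /eqaddoP/(_ _ e_gt0) := diff_locally df.
rewrite near_simpl /= => rem.
have h_0 : (fun k => x k - xs) @ \oo --> (0 : 'rV[R]_n).
  by rewrite -(subrr xs); apply: cvgB x_xs (cvg_cst _).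
have dq : ('d f xs ((t k)^-1 *: (x k - xs))) @[k --> \oo] --> L.
  by rewrite LE; apply: continuous_cvg q_d; exact: diff_continuous.
have dq_lt : \forall k \near \oo, 'd f xs ((t k)^-1 *: (x k - xs)) < L / 2.
  by apply: (cvgr_lt L dq); lra.
have q_lt : \forall k \near \oo, `|(t k)^-1 *: (x k - xs)| < `|d| + 1.
  by apply: (cvgr_norm_lt d q_d); rewrite ltrDl.
have fmin_x : \forall k \near \oo, X (x k) -> f xs <= f (x k) := x_xs _ fmin.
have rem_x : \forall k \near \oo,
    `|f (x k) - (f xs + 'd f xs (x k - xs))| <= e * `|x k - xs|.
  have := h_0 _ rem; apply: (@filterS _ \oo) => k /=.
  by rewrite !fctE /= subrK.
near \oo => k.
have tk := t_gt0 k.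
have fk : f xs <= f (x k) by move: (Xx k); near: k.
have dqk : 'd f xs ((t k)^-1 *: (x k - xs)) < L / 2 by near: k.
have qk : `|(t k)^-1 *: (x k - xs)| < `|d| + 1 by near: k.
have : `|f (x k) - (f xs + 'd f xs (x k - xs))| <= e * `|x k - xs| by near: k.
move: dqk qk; set q := _ *: _ => dqk qk.
have -> : x k - xs = t k *: q by rewrite scalerA divff ?scale1r// gt_eqF.
rewrite linearZ normrZ (gtr0_norm tk) mulrCA => /ler_normlP[_] {}rem.
have eq_lt : t k * (e * `|q|) < t k * (- L / 4).
  by rewrite ltr_pM2l// -eE ltr_pM2l.
have dq_le : t k * 'd f xs q < t k * (L / 2) by rewrite ltr_pM2l.
have tL_lt0 : t k * L < 0 by rewrite pmulr_rlt0.
have {}rem : f (x k) - (f xs + t k * 'd f xs q) <= t k * (e * `|q|) := rem.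
lra.
Unshelve. all: by end_near.
Qed.

Theorem theorem2 (R : realType) (n ng nh nH nG : nat)
    (nH_ge1 : (1 <= nH)%N) (nG_ge1 : (1 <= nG)%N)
    (P : mpbvc R n ng nh nH nG) (P_C2 : C2_data P)
    (xs : 'rV[R]_n) (xs_min : local_minimum P xs) (xs_gcq : GCQ P xs) :
  exists (mug : 'rV[R]_ng) (muh : 'rV[R]_nh)
         (muG : 'M[R]_(nH, nG)) (muH : 'rV[R]_nH),
    grad (mp_f P) xs
      - \sum_(k < ng) mug ord0 k *: grad (coordf (mp_g P) k) xs
      - \sum_(l < nh) muh ord0 l *: grad (coordf (mp_h P) l) xs
      - \sum_(i < nH) \sum_(j < nG) muG i j *: grad (mp_G P i j) xs
      - \sum_(i < nH) muH ord0 i *: grad (mp_H P i) xs = 0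
    /\ (forall k : 'I_ng, mp_g P xs ord0 k = 0)
    /\ (forall l : 'I_nh, 0 <= muh ord0 l /\ 0 <= mp_h P xs ord0 l
          /\ muh ord0 l * mp_h P xs ord0 l = 0)
    /\ (forall i : 'I_nH, (projH (I_pp P xs) `|` projH (I_p0 P xs)) i ->
          muH ord0 i = 0)
    /\ (forall i : 'I_nH, I0H P xs i ->
          ~ (exists j : 'I_nG, I_0m P xs (i, j)) -> 0 <= muH ord0 i)
    /\ (forall (i : 'I_nH) (j : 'I_nG), I_p0 P xs (i, j) -> 0 <= muG i j)
    /\ (forall (i : 'I_nH) (j : 'I_nG), ~ I_p0 P xs (i, j) -> muG i j = 0).
Proof.
have [xs_feas f_min] := xs_min.
have [[f_diff _ _] _ _ _ _] := P_C2.
have [g0 h_ge0 _ _] := xs_feas.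
have : polar (tangent_cone (feasible P) xs) (- grad (mp_f P) xs).
  move=> d Td; rewrite dotvNl oppr_le0.
  exact: tangent_cone_grad_ge0 (f_diff xs) f_min Td.
rewrite -xs_gcq => polarL.
(* The summands index [g], [h], [G] and [H] in this order. Placing [projH (I_0m P xs)] in [E] is
   what leaves the corresponding [muH] free in sign. *)
pose I := ('I_ng + 'I_nh + ('I_nH * 'I_nG + 'I_nH))%type.
pose E (s : I) : bool := match s with
  | inl (inl k) => true
  | inr (inr i) => `[< projH (I_0m P xs) i >]
  | _ => false end.
pose A (s : I) : bool := match s with
  | inl (inr l) => `[< Ih P xs l >]
  | inr (inl ij) => `[< I_p0 P xs ij >]
  | inr (inr i) => `[< (projH (I_00 P xs) `|` projH (I_0p P xs)) i >]
  | _ => false end.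
pose a (s : I) : 'rV[R]_n := match s with
  | inl (inl k) => grad (coordf (mp_g P) k) xs
  | inl (inr l) => grad (coordf (mp_h P) l) xs
  | inr (inl ij) => grad (mp_G P ij.1 ij.2) xs
  | inr (inr i) => grad (mp_H P i) xs end.
have [d E0 A_ge0|lam [fE lam_ge0 lam0]] :=
    @farkas R n I E A a (grad (mp_f P) xs).
  rewrite -oppr_le0 -dotvNl; apply: polarL; split.
  - by move=> k; exact: (E0 (inl (inl k))).
  - by move=> l hl; apply: (A_ge0 (inl (inr l))); apply/asboolP.
  - by move=> i Ii; apply: (E0 (inr (inr i))); apply/asboolP.
  - by move=> i Ii; apply: (A_ge0 (inr (inr i))); apply/asboolP.
  - by move=> i j Iij; apply: (A_ge0 (inr (inl (i, j)))); apply/asboolP.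
exists (\row_k lam (inl (inl k))), (\row_l lam (inl (inr l))),
  (\matrix_(i, j) lam (inr (inl (i, j)))), (\row_i lam (inr (inr i))).
split.
  under eq_bigr do rewrite mxE.
  under [in X in _ - X - _ - _]eq_bigr do rewrite mxE.
  under [in X in _ - X - _]eq_bigr do under eq_bigr do rewrite mxE.
  under [in X in _ - X]eq_bigr do rewrite mxE.
  rewrite fE !big_sumType /= pair_bigA /=.
  rewrite [X in _ + (X + _)](eq_bigr (fun p : 'I_nH * 'I_nG =>
    lam (inr (inl (p.1, p.2))) *: grad (mp_G P p.1 p.2) xs)); last by case.
  by rewrite -!addrA -!opprD !addrA subrr.
split=> //; split=> [l|].
  rewrite mxE; split; first exact: lam_ge0.
  (* Complementarity: if [h_l] is nonzero at [xs], its index lies in neither [E] nor [A], so its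
     multiplier vanishes. *)
  split=> //; have [->|/eqP hl] := eqVneq (mp_h P xs ord0 l) 0.
    by rewrite mulr0.
  by rewrite lam0 ?mul0r//; apply/asboolP.
split=> [i Hi|].
  (* A positive [H_i] keeps [i] out of all three index sets with [H_i = 0], hence out of [E] and
     [A]. *)
  have Hi_gt0 : 0 < mp_H P i xs by case: Hi => -[j []].
  rewrite mxE lam0//; apply/asboolP.
    by case=> j [/= Hi0]; rewrite Hi0 ltxx in Hi_gt0.
  by case=> -[j [/= Hi0]]; rewrite Hi0 ltxx in Hi_gt0.
split=> [i _ nI|]; first by rewrite mxE lam_ge0//; apply/asboolP.
split=> i j Iij; rewrite mxE; first exact: lam_ge0.
by apply: lam0 => //; apply/asboolP.
Qed.
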